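(* Let $X$ be a compact and countable metrizable space. Then the space $(\mathrm{Met}(X),\mathcal{D}_X)$ is not universal for all compact metric spaces. Namely, there exists a compact metric space that cannot be isometrically embedded into $(\mathrm{Met}(X),\mathcal{D}_X)$.
   Context: For a metrizable space $X$, $\mathrm{Met}(X)$ is the set of all metrics on $X$ that generate the given topology of $X$, equipped with the sup-metric $\mathcal{D}_X(d,e)=\sup_{x,y\in X}|d(x,y)-e(x,y)|$. A space $(M,\rho)$ is universal for a class of metric spaces if every member of the class admits an isometric (distance-preserving, not necessarily surjective) embedding into $(M,\rho)$. *)

(* Defs.v *)
From HB Require Import structures.
From mathcomp Require Import all_boot all_order all_algebra.
From mathcomp Require Import all_classical all_reals all_analysis.

Set Implicit Arguments.
Unset Strict Implicit.
Unset Printing Implicit Defensive.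

Import Order.TTheory GRing.Theory Num.Theory.
Import numFieldNormedType.Exports.

Local Open Scope classical_set_scope.
Local Open Scope ring_scope.

Definition is_metric (R : realType) (T : Type) (d : T -> T -> R) : Prop :=
  [/\ forall x y, 0 <= d x y,
      forall x y, d x y = 0 <-> x = y,
      forall x y, d x y = d y x &
      forall x y z, d x z <= d x y + d y z].

Definition generates_topology (R : realType) (X : topologicalType)
    (d : X -> X -> R) : Prop :=
  forall U : set X, open U <->
    forall x, U x -> exists2 r : R, 0 < r & [set y | d x y < r] `<=` U.

Definition Met (R : realType) (X : topologicalType) : set (X -> X -> R) :=
  [set d | is_metric d /\ generates_topology d].

Arguments Met : clear implicits.

Definition metrizable (R : realType) (X : topologicalType) : Prop :=
  Met R X !=set0.

(* The supremum is taken in [0, +oo]: it may be infinite when X is not compact,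
   and the added point 0 only matters when X is empty, since
   ereal_sup set0 = -oo. *)
Definition sup_metric (R : realType) (X : Type) (d e : X -> X -> R) : \bar R :=
  ereal_sup (0%E |` [set (`|d p.1 p.2 - e p.1 p.2|)%:E | p in [set: X * X]]).

(* The target is a subset M of T with a [0, +oo]-valued distance rho. *)
Definition isometric_embedding (R : realType) (Y : metricType R) (T : Type)
    (M : set T) (rho : T -> T -> \bar R) (f : Y -> T) : Prop :=
  (forall y, M (f y)) /\ (forall y z, rho (f y) (f z) = (mdist y z)%:E).

Definition embeds_isometrically (R : realType) (Y : metricType R) (T : Type)
    (M : set T) (rho : T -> T -> \bar R) : Prop :=
  exists f : Y -> T, isometric_embedding M rho f.

Definition universal_for (R : realType) (C : metricType R -> Prop) (T : Type)
    (M : set T) (rho : T -> T -> \bar R) : Prop :=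
  forall Y : metricType R, C Y -> embeds_isometrically Y M rho.

Definition compact_metric_space (R : realType) (Y : metricType R) : Prop :=
  compact [set: Y].

(* Main.v *)
Require Import Defs.
From HB Require Import structures.
From mathcomp Require Import all_boot all_order all_algebra.
From mathcomp Require Import all_classical all_reals all_analysis.
From mathcomp Require Import lra.

(** Any isometric embedding of [Y] into [Met X] gives, for every [p] in the
countable set [X * X], a 1-Lipschitz function [y |-> f y p] on [Y], and by
compactness every distance in [Y] is realized as a difference of values of one
of these functions. So it suffices to find a compact metric space carrying
uncountably many pairs of points no two of which can have their distances
realized by the same 1-Lipschitz function. The ladder [{0, 1} * [0, 1]], with
[d((i, s), (i, t)) = |s - t|] and [d((0, s), (1, t)) = 2 - |s - t|], has this
property for the pairs [((0, t), (1, t))]. *)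

Set Implicit Arguments.
Unset Strict Implicit.
Unset Printing Implicit Defensive.

Import Order.TTheory GRing.Theory Num.Theory.
Import numFieldNormedType.Exports.

Local Open Scope classical_set_scope.
Local Open Scope ring_scope.

Section ladder.
Variable R : realType.

Definition ladder : Type := (bool * {x : R | 0 <= x <= 1})%type.

(** Only the choice structure of the pair is copied, so that the topology of [ladder] is the one
    induced by [ladder_dist]. *)
HB.instance Definition _ :=
  Choice.copy ladder (bool * {x : R | 0 <= x <= 1})%type.

Definition ladder_dist (p q : ladder) : R :=
  let d := `|val p.2 - val q.2| in if p.1 == q.1 then d else 2 - d.

Lemma ladder_distxx p : ladder_dist p p = 0.
Proof. by rewrite /ladder_dist eqxx subrr normr0. Qed.

Lemma ladder_dist_sym p q : ladder_dist p q = ladder_dist q p.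
Proof. by rewrite /ladder_dist eq_sym distrC. Qed.

Lemma unit_itv_dist_le1 (s t : {x : R | 0 <= x <= 1}) : `|val s - val t| <= 1.
Proof.
case: s t => [s /= /andP[s0 s1]] [t /= /andP[t0 t1]].
by rewrite ler_norml; apply/andP; split; lra.
Qed.

Lemma ladder_dist_positivity p q : ladder_dist p q = 0 -> p = q.
Proof.
case: p q => [i s] [j t]; rewrite /ladder_dist /=; case: eqP => [-> /eqP|_].
  by rewrite normr_eq0 subr_eq0 => /eqP/val_inj ->.
by have := unit_itv_dist_le1 s t => *; exfalso; lra.
Qed.

(** Distances along a rail are at most 1 and those across are at least 1. If [p] and [r] share a
    rail and [q] does not, these bounds suffice; every other case is a triangle inequality in the
    reals. *)
Lemma ladder_dist_triangle q p r :
  ladder_dist p r <= ladder_dist p q + ladder_dist q r.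
Proof.
case: p q r => [i s] [j t] [k u]; rewrite /ladder_dist /=.
have st := unit_itv_dist_le1 s t.
have tu := unit_itv_dist_le1 t u.
have su := unit_itv_dist_le1 s u.
have stu := ler_distD (val t) (val s) (val u).
have sut := ler_distD (val u) (val s) (val t).
have tsu := ler_distD (val s) (val t) (val u).
rewrite (distrC (val u)) in sut; rewrite (distrC (val t) (val s)) in tsu.
by case: i j k => [] [] [] /=; lra.
Qed.

HB.instance Definition _ := isMetric.Build R ladder
  ladder_distxx ladder_dist_positivity ladder_dist_sym ladder_dist_triangle.

(** Each rail is an isometric image of the unit interval, and the two rails cover the ladder. *)
Lemma ladder_compact : compact [set: ladder].
Proof.
have zero_itv : 0 <= (0 : R) <= 1 by rewrite lexx ler01.
(* [insubd] makes [rail i] total, with parameter 0 outside the unit interval. *)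
pose rail i x : ladder := (i, insubd (exist _ 0 zero_itv) x).
have rail_compact i : compact (rail i @` `[0, 1]).
  apply: continuous_compact; last exact: segment_compact.
  apply/subspace_continuousP => x x01.
  apply/metricType_numDomainType.cvgrPdist_lt => e e0.
  rewrite near_withinE; near=> y => y01.
  rewrite /mdist /= /ladder_dist /= eqxx !val_insubd.
  move: x01 y01; rewrite /= !in_itv /= => -> ->.
  by near: y; apply: cvgr_dist_lt.
have -> : [set: ladder] = rail false @` `[0, 1] `|` rail true @` `[0, 1].
  apply/seteqP; split => // -[i t] _; have := valP t => t01.
  have iE : rail i (val t) = (i, t) by rewrite /rail valKd.
  by case: i iE => iE; [right|left]; exists (val t) => //=; rewrite in_itv.
exact: compactU.
Unshelve. all: by end_near. Qed.

(** Let [d] be the distance from [s] to [t]. If the two differences have the same sign, exchanging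
    their subtracted terms bounds their sum by [2 * (2 - d)], so 4 <= 4 - 2d and d = 0. If the signs
    are opposite, comparing along the rails gives 4 <= 2d, against d <= 1. *)
Lemma ladder_rung_eq (g : ladder -> R) (s t : {x : R | 0 <= x <= 1}) :
  (forall p q, `|g p - g q| <= mdist p q) ->
  `|g (false, s) - g (true, s)| = 2 -> `|g (false, t) - g (true, t)| = 2 ->
  s = t.
Proof.
move=> g_lip gs gt.
have d1 := unit_itv_dist_le1 s t.
have d0 : 0 <= `|val s - val t| by [].
have ff : `|g (false, s) - g (false, t)| <= `|val s - val t| := g_lip _ _.
have tt' : `|g (true, s) - g (true, t)| <= `|val s - val t| := g_lip _ _.
have ft : `|g (false, s) - g (true, t)| <= 2 - `|val s - val t| := g_lip _ _.
have tf : `|g (true, s) - g (false, t)| <= 2 - `|val s - val t| := g_lip _ _.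
apply/val_inj/eqP; rewrite -subr_eq0 -normr_eq0 eq_le d0 andbT.
move: d1 d0 ff tt' ft tf gs gt; move: `|val s - val t| => d d1 d0.
rewrite !ler_norml => /andP[? ?] /andP[? ?] /andP[? ?] /andP[? ?].
case: (ler0P (g (false, s) - _)) => ? ?;
  by case: (ler0P (g (false, t) - _)) => ? ?; lra.
Qed.

End ladder.

(** A countable set has Lebesgue measure 0, while the interval has measure 1. *)
Lemma unit_itv_uncountable (R : realType) : ~ countable (`[0, 1] : set R).
Proof.
move=> /countable_lebesgue_measure0; rewrite lebesgue_measure_itv /= lte_fin.
by rewrite ltr01 sube0 => -[]/eqP; rewrite oner_eq0.
Qed.

Section sup_metric.
Variables (R : realType) (X : topologicalType).
Implicit Types d e : X -> X -> R.

Lemma Met_ball_nbhs d x (r : R) :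
  Met R X d -> 0 < r -> nbhs x [set y | d x y < r].
Proof.
move=> [[_ d0 _ dtri] dgen] r0; apply: open_nbhs_nbhs; split; last first.
  by rewrite /= (d0 x x).2.
apply/dgen => y /= dxy; exists (r - d x y); first by rewrite subr_gt0.
by move=> z /= dyz; have := dtri x y z; lra.
Qed.

Lemma Met_continuous d :
  Met R X d -> continuous (fun p : X * X => d p.1 p.2).
Proof.
move=> dM [x y]; apply/cvgrPdist_lt => e e0 /=.
have e20 : 0 < e / 2 by rewrite divr_gt0.
have [[_ _ dsym dtri] _] := dM.
(* [d x y] and [d u v] differ by at most [d x u + d y v]. *)
exists ([set u | d x u < e / 2], [set v | d y v < e / 2]).
  by split; exact: Met_ball_nbhs.
move=> [u v] /= [xu yv]; rewrite ltr_norml.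
have := dtri x u y; have := dtri u v y; have := dtri u x v; have := dtri x y v.
by rewrite (dsym v y) (dsym u x) => *; apply/andP; split; lra.
Qed.

Lemma sup_metric_ge d e p : (`|d p.1 p.2 - e p.1 p.2|%:E <= sup_metric d e)%E.
Proof. by apply: ereal_sup_ubound; right; exists p. Qed.

Lemma sup_metric_attained d e (r : R) :
  compact [set: X] -> Met R X d -> Met R X e ->
  0 < r -> sup_metric d e = r%:E -> exists p, `|d p.1 p.2 - e p.1 p.2| = r.
Proof.
move=> cX dM eM r0 der.
have [X0|] := pselect ([set: X * X] !=set0); last first.
  (* For empty [X] only the added point 0 remains, so the supremum is 0, against [0 < r]. *)
  move=> /set0P/negP/negPn/eqP X0.
  move: der; rewrite /sup_metric X0 image_set0 setU0 ereal_sup1 => -[r0'].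
  by rewrite -r0' ltxx in r0.
have cXX : compact [set: X * X] by rewrite -setXTT; exact: compact_setX.
pose F (p : X * X) := `|d p.1 p.2 - e p.1 p.2|.
have cF : {within [set: X * X], continuous F}.
  apply: continuous_subspaceT => p; apply: cvg_norm.
  by apply: cvgB; exact: Met_continuous.
have [p _ pmax] := compact_EVT_max X0 cXX cF.
exists p; apply/eqP; rewrite eq_le; apply/andP; split.
  by rewrite -lee_fin -der sup_metric_ge.
rewrite -lee_fin -der; apply: ge_ereal_sup => _ [->|[q _ <-]].
  by rewrite lee_fin normr_ge0.
by rewrite lee_fin (pmax q) ?in_setT.
Qed.

End sup_metric.

Lemma ladder_not_embeds (R : realType) (X : topologicalType) :
  compact [set: X] -> countable [set: X] ->
  ~ embeds_isometrically (ladder R) (Met R X) (@sup_metric R X).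
Proof.
move=> cX countX [f [fM fiso]].
have f_lip p y z : `|f y p.1 p.2 - f z p.1 p.2| <= mdist y z.
  by rewrite -lee_fin -fiso sup_metric_ge.
(* The ends of each rung are at distance 2, which some pair in [X * X] realizes. *)
have /choice[c cP] (t : {x : R | 0 <= x <= 1}) : exists p : X * X,
    `|f (false, t) p.1 p.2 - f (true, t) p.1 p.2| = 2.
  apply: sup_metric_attained => //; rewrite fiso /mdist /= /ladder_dist /=.
  by rewrite subrr normr0 subr0.
(* A pair shared by two rungs would give a single 1-Lipschitz function of [y] with difference 2 on
   both. *)
have c_inj : injective c.
  move=> s t cst; apply: (ladder_rung_eq (f_lip (c s))) => //.
  by rewrite cst; exact: cP.
have countXX : countable [set: X * X] by rewrite -setXTT; exact: countableX.
have /countable_injP[h h_inj] := countXX.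
have zero_itv : 0 <= (0 : R) <= 1 by rewrite lexx ler01.
apply: (@unit_itv_uncountable R); apply/countable_injP.
(* On the unit interval [insubd] keeps the value, so this composite injects the interval into the
   naturals. *)
exists (h \o c \o insubd (exist _ 0 zero_itv)) => x y.
rewrite !inE /= !in_itv /= => x01 y01 /h_inj; rewrite !in_setT => /(_ isT isT).
by move=> /c_inj /(congr1 val); rewrite !val_insubd x01 y01.
Qed.

Theorem theorem1p8 (R : realType) (X : topologicalType)
    (X_metrizable : metrizable R X)
    (X_compact : compact [set: X])
    (X_countable : countable [set: X]) :
  ~ universal_for (@compact_metric_space R) (Met R X) (@sup_metric R X) /\
  exists Y : metricType R,
    compact_metric_space Y /\
    ~ embeds_isometrically Y (Met R X) (@sup_metric R X).
Proof.
have not_embeds := ladder_not_embeds (R := R) X_compact X_countable.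
split; last by exists (ladder R); split => //; exact: ladder_compact.
by move=> /(_ (ladder R) (@ladder_compact R)).
Qed.
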